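(* Let $U$ and $A$ be algebras over a field $k$ and let $H = U\otimes A$ be an algebra structure on the tensor product of the underlying vector spaces of $U$ and $A$ which satisfies $$(u\otimes a)(u'\otimes a') = uu'\otimes aa' \quad\text{whenever } a = 1 \text{ or } u' = 1 .$$ Suppose that $U'$ is a subalgebra of $U$ with $(u\otimes a)\cdot_\chi u' = \chi(a)uu'$ for all $u\in U$, $a\in A$, $\chi\in \mathrm{Alg}(A,k)$, $u'\in U'$, and with $\mathrm{Alg}(U,k)\to \mathrm{Alg}(U',k)$ (restriction) one-one; and suppose that $A'$ is a subalgebra of $A$ with $a'\cdot_\rho (u\otimes a) = \rho(u)a'a$ for all $a'\in A'$, $\rho\in\mathrm{Alg}(U,k)$, $u\in U$, $a\in A$, and with $\mathrm{Alg}(A,k)\to\mathrm{Alg}(A',k)$ (restriction) one-one. Then: a) Every object of ${}_H\underline{\mathcal M}$ has a unique one-dimensional left $A$-submodule and a unique codimension one left $U$-submodule. b) If $f: M\to M'$ is a left $H$-module map, where $M$ and $M'$ are objects of ${}_H\underline{\mathcal M}$, then $f=0$ or $f$ is an isomorphism.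
   Context: Algebras are associative and unital; $\otimes=\otimes_k$; $\mathrm{Alg}(X,k)$ is the set of unital algebra homomorphisms $X\to k$. $U$ and $A$ are regarded as subalgebras of $H$ via $u\mapsto u\otimes 1$ and $a\mapsto 1\otimes a$; thus $H$-modules are $U$- and $A$-modules. For $\chi\in\mathrm{Alg}(A,k)$, $U_\chi$ is the left $H$-module with underlying space $U$ and action $$(u\otimes a)\cdot_\chi u' = u\,\big((\mathrm{id}_U\otimes\chi)((1\otimes a)(u'\otimes 1))\big).$$ For $\rho\in\mathrm{Alg}(U,k)$, $A_\rho$ is the right $H$-module with underlying space $A$ and action $$a\cdot_\rho(u\otimes a') = \big((\rho\otimes\mathrm{id}_A)((1\otimes a)(u\otimes 1))\big)\,a' .$$ ${}_H\underline{\mathcal M}$ is the category whose objects are the left $H$-modules $M$ which are generated (as $H$-modules) by some one-dimensional left $A$-submodule $km$ and which have some codimension one left $U$-submodule $N$ such that $(0)$ is the only left $H$-submodule of $M$ contained in $N$; morphisms are left $H$-module maps. *)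

(* Defs.v *)
From HB Require Import structures.
From mathcomp Require Import all_boot all_algebra sesquilinear.
From mathcomp Require Import boolp classical_sets.
Set Implicit Arguments.
Unset Strict Implicit.
Unset Printing Implicit Defensive.
Import GRing.Theory.
Local Open Scope ring_scope.
Local Open Scope classical_set_scope.

Section TensorProduct.
Variables (k : fieldType) (U A T : lmodType k).

(* T, together with the pure-tensor map t, is the tensor product of U and A
   over k, in the sense of the universal property. *)
Definition is_tensor_product (t : {bilinear U -> A -> T}) : Prop :=
  forall (V : lmodType k) (f : {bilinear U -> A -> V}),
    exists g : {linear T -> V},
      (forall u a, g (t u a) = f u a) /\
      (forall g' : {linear T -> V},
         (forall u a, g' (t u a) = f u a) -> g' =1 g).

Variables (t : {bilinear U -> A -> T}) (tP : is_tensor_product t).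

Definition tensor_lift (V : lmodType k) (f : {bilinear U -> A -> V}) :
  {linear T -> V} := sval (cid (tP f)).

Lemma tensor_liftE (V : lmodType k) (f : {bilinear U -> A -> V}) u a :
  tensor_lift f (t u a) = f u a.
Proof. by rewrite /tensor_lift; case: cid => g [gE _] /=; apply: gE. Qed.

End TensorProduct.

Section TensorCharacter.
Variables (k : fieldType) (U A : algType k).

Definition scale_right (chi : {lrmorphism A -> k^o}) (u : U) (a : A) : U :=
  (chi a : k) *: u.

Definition scale_left (rho : {lrmorphism U -> k^o}) (u : U) (a : A) : A :=
  (rho u : k) *: a.

Lemma scale_right_bilinear chi :
  bilinear_for (GRing.Scale.Law.clone _ _ *:%R _)
               (GRing.Scale.Law.clone _ _ *:%R _) (scale_right chi).
Proof.
split=> [a c u v|u c a b]; rewrite /= /scale_right.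
- by rewrite scalerDr !scalerA mulrC.
- have -> : (chi (c *: a + b) : k) = c * (chi a : k) + (chi b : k).
    exact: (linearP chi).
  by rewrite scalerDl scalerA.
Qed.

Lemma scale_left_bilinear rho :
  bilinear_for (GRing.Scale.Law.clone _ _ *:%R _)
               (GRing.Scale.Law.clone _ _ *:%R _) (scale_left rho).
Proof.
split=> [a c u v|u c a b]; rewrite /= /scale_left.
- have -> : (rho (c *: u + v) : k) = c * (rho u : k) + (rho v : k).
    exact: (linearP rho).
  by rewrite scalerDl scalerA.
- by rewrite scalerDr !scalerA mulrC.
Qed.

HB.instance Definition _ chi :=
  bilinear_isBilinear.Build k U A U _ _ (scale_right chi)
    (scale_right_bilinear chi).

HB.instance Definition _ rho :=
  bilinear_isBilinear.Build k U A A _ _ (scale_left rho)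
    (scale_left_bilinear rho).

Variables (H : algType k) (t : {bilinear U -> A -> H}).
Variable (tP : is_tensor_product t).

(* id_U (x) chi : H -> U and rho (x) id_A : H -> A, with U (x) k and k (x) A
   identified with U and A. *)
Definition id_tensor (chi : {lrmorphism A -> k^o}) : {linear H -> U} :=
  tensor_lift tP (scale_right chi).

Definition tensor_id (rho : {lrmorphism U -> k^o}) : {linear H -> A} :=
  tensor_lift tP (scale_left rho).

Lemma id_tensorE chi u a : id_tensor chi (t u a) = (chi a : k) *: u.
Proof. exact: tensor_liftE. Qed.

Lemma tensor_idE rho u a : tensor_id rho (t u a) = (rho u : k) *: a.
Proof. exact: tensor_liftE. Qed.

(* (u (x) a) ._chi u', the action defining the left H-module U_chi. *)
Definition act_chi (chi : {lrmorphism A -> k^o}) (u : U) (a : A) (u' : U) : U :=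
  u * id_tensor chi (t 1 a * t u' 1).

(* a ._rho (u (x) a'), the action defining the right H-module A_rho. *)
Definition act_rho (rho : {lrmorphism U -> k^o}) (a : A) (u : U) (a' : A) : A :=
  tensor_id rho (t 1 a * t u 1) * a'.

End TensorCharacter.

(* The restriction map Alg(X, k) -> Alg(X', k) is one-one. *)
Definition restriction_one_one (k : fieldType) (X : algType k) (X' : set X) :=
  forall chi chi' : {lrmorphism X -> k^o},
    (forall x, X' x -> chi x = chi' x) -> chi =1 chi'.

Section Modules.
Variables (k : fieldType) (H : algType k).

(* N is a submodule of the restriction of M to a subalgebra B of H. *)
Definition submodule_over (M : lmodType H) (B : set H) (N : set M) : Prop :=
  [/\ N 0, forall x y, N x -> N y -> N (x + y)
    & forall b x, B b -> N x -> N (b *: x)].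

Definition Hsubmodule (M : lmodType H) (N : set M) : Prop :=
  submodule_over [set: H] N.

(* M is a k-vector space through k -> H, c |-> c%:A. *)
Definition kline (M : lmodType H) (m : M) : set M :=
  [set c%:A *: m | c in [set: k]].

Definition one_dimensional (M : lmodType H) (L : set M) : Prop :=
  exists2 m : M, m <> 0 & L = kline m.

(* For a subspace N: M / N has dimension one, with basis the class of m. *)
Definition codimension_one (M : lmodType H) (N : set M) : Prop :=
  exists2 m : M, ~ N m & forall x, exists c : k, N (x - c%:A *: m).

Definition generated_by (M : lmodType H) (S : set M) : Prop :=
  forall N : set M, Hsubmodule N -> S `<=` N -> N = [set: M].

Variables (U A : algType k) (t : {bilinear U -> A -> H}).

Definition Usubmodule (M : lmodType H) (N : set M) : Prop :=
  submodule_over [set t u 1 | u in [set: U]] N.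

Definition Asubmodule (M : lmodType H) (N : set M) : Prop :=
  submodule_over [set t 1 a | a in [set: A]] N.

(* M is an object of the category _H \underline{M}; its morphisms are all the
   maps {linear M -> M'}. *)
Definition HM_object (M : lmodType H) : Prop :=
  (exists L : set M, [/\ Asubmodule L, one_dimensional L & generated_by L]) /\
  (exists N : set M, [/\ Usubmodule N, codimension_one N
     & forall P : set M, Hsubmodule P -> P `<=` N -> P = [set 0]]).

End Modules.

(* Main.v *)
(* Let k m be an A-stable line with character chi generating M, and let p be a
   functional on M with p (u x) = rho u * p x whose kernel contains no nonzero
   H-submodule.  Then M = U m, and x is determined by the values p (a x).  The
   hypothesis on A' gives p (a x) = chi a * p x for a in A' and all x, so any
   A-eigenvector of M has a character agreeing with chi on A', hence everywhere,
   and is therefore proportional to m.  Dually, the hypothesis on U' gives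
   u m = rho u *: m for u in U', which makes p unique up to scalars.  A nonzero
   morphism sends m to a nonzero multiple of m' and pulls p' back to a nonzero
   multiple of p; this gives surjectivity and injectivity. *)
From HB Require Import structures.
Require Import Defs.
From mathcomp Require Import all_boot all_algebra sesquilinear.
From mathcomp Require Import boolp classical_sets.
Import GRing.Theory.
Set Implicit Arguments.
Unset Strict Implicit.
Local Open Scope ring_scope.
Local Open Scope classical_set_scope.

(** * Linear maps and characters from bare functions; equality of maps on a tensor product *)

Section LinearMaps.
Variable k : fieldType.

Lemma linear_ex (V W : lmodType k) (f : V -> W) :
  (forall c x y, f (c *: x + y) = c *: f x + f y) ->
  exists g : {linear V -> W}, forall x, g x = f x.
Proof.
move=> fL; pose L := GRing.isLinear.Build k V W *:%R f fL.
by exists (HB.pack f L : {linear V -> W}).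
Qed.

Lemma character_ex (B : algType k) (f : B -> k) :
  (forall c x y, f (c *: x + y) = c * f x + f y) ->
  f 1 = 1 -> (forall x y, f (x * y) = f x * f y) ->
  exists chi : {lrmorphism B -> k^o}, forall x, chi x = f x.
Proof.
move=> fL f1 fM; pose f' : B -> k^o := f.
pose L := GRing.isLinear.Build k B k^o *:%R f' fL.
pose M := GRing.isMonoidMorphism.Build B k^o f' (f1, fM).
by exists (HB.pack f' L M : {lrmorphism B -> k^o}).
Qed.

Lemma characterP (B : algType k) (chi : {lrmorphism B -> k^o}) c x y :
  (chi (c *: x + y) : k) = c * (chi x : k) + (chi y : k).
Proof. exact: (linearP chi). Qed.

Lemma characterZ (B : algType k) (chi : {lrmorphism B -> k^o}) c x :
  (chi (c *: x) : k) = c * (chi x : k).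
Proof. exact: (linearZ_LR chi). Qed.

(** Both maps factor the same bilinear map through [t], so uniqueness in the universal property
    applies. Linearity is a plain hypothesis so that expressions such as [p (h *: x)] can be
    compared directly. *)
Lemma tensor_ext (U A T V : lmodType k) (t : {bilinear U -> A -> T})
    (f g : T -> V) :
  is_tensor_product t ->
  (forall c x y, f (c *: x + y) = c *: f x + f y) ->
  (forall c x y, g (c *: x + y) = c *: g x + g y) ->
  (forall u a, f (t u a) = g (t u a)) -> f =1 g.
Proof.
move=> tP /linear_ex[f' f'E] /linear_ex[g' g'E] fg.
pose b u a := f' (t u a).
have bP : bilinear_for (GRing.Scale.Law.clone _ _ *:%R _)
    (GRing.Scale.Law.clone _ _ *:%R _) b.
  by split=> [a c u v|u c a a']; rewrite /b /= ?linearPl ?linearPr linearP.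
pose B := bilinear_isBilinear.Build k U A V _ _ b bP.
have [h [_ hU]] := tP V (HB.pack b B : {bilinear U -> A -> V}).
move=> x; rewrite -f'E -g'E (hU f') // (hU g') //.
by move=> u a; rewrite g'E -fg -f'E.
Qed.

End LinearMaps.

(** * Characters afforded by stable lines and stable hyperplanes *)

Section Characters.
Variables (k : fieldType) (H : algType k) (M : lmodType H).
Implicit Types (c d : k) (x y m : M) (h : H).

(** [M] is declared only as an [H]-module, so [k] acts on it through [c%:A], and k-linearity is
    spelled out by hand. *)
Definition klinear (p : M -> k) :=
  forall c x y, p ((c%:A : H) *: x + y) = c * p x + p y.

Lemma klinearD p x y : klinear p -> p (x + y) = p x + p y.
Proof. by move=> pL; rewrite -{1}[x]scale1r -(scale1r 1) pL mul1r. Qed.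

Lemma klinear0 p : klinear p -> p 0 = 0.
Proof. by move=> pL; apply: (@addrI _ (p 0)); rewrite -klinearD // !addr0. Qed.

Lemma klinearZ p c x : klinear p -> p ((c%:A : H) *: x) = c * p x.
Proof. by move=> pL; rewrite -[_ *: x]addr0 pL klinear0 ?addr0. Qed.

Lemma klinearB p x y : klinear p -> p (x - y) = p x - p y.
Proof. by move=> pL; apply: (addIr (p y)); rewrite -klinearD // !subrK. Qed.

Lemma kscaleC h c x : h *: ((c%:A : H) *: x) = (c%:A : H) *: (h *: x).
Proof. by rewrite !scalerA mulr_algl mulr_algr. Qed.

Lemma kscaleAl c h x : (c *: h) *: x = (c%:A : H) *: (h *: x).
Proof. by rewrite scalerA mulr_algl. Qed.

Lemma kscaleA c d x :
  (c%:A : H) *: ((d%:A : H) *: x) = ((c * d)%:A : H) *: x.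
Proof. by rewrite scalerA mulr_algl scalerA. Qed.

Lemma kscaleI c d m : m <> 0 -> (c%:A : H) *: m = (d%:A : H) *: m -> c = d.
Proof.
move=> m0 cd; apply/eqP/negPn/negP; rewrite -subr_eq0 => cd0; apply: m0.
(* Writes [m] as [1%:A *: m], then 1 as [(c - d)^-1 * (c - d)]. *)
rewrite -[m]scale1r -(scale1r 1) -(mulVf cd0) -kscaleA scalerBl scalerBl cd.
by rewrite subrr scaler0.
Qed.

Variables (B : algType k) (j : B -> H).
Hypothesis jL : forall c b b', j (c *: b + b') = c *: j b + j b'.
Hypothesis j1 : j 1 = 1.
Hypothesis jM : forall b b', j (b * b') = j b * j b'.

(** As [m] is nonzero, the coefficient of [j b *: m] along [m] is unique, which forces it to be
    linear and multiplicative in [b]. The map [j] stands for the embedding of [U] or of [A]. *)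
Lemma eigenvector_character m : m <> 0 ->
  submodule_over [set j b | b in [set: B]] (kline (k := k) m) ->
  exists chi : {lrmorphism B -> k^o},
    forall b, j b *: m = ((chi b : k)%:A : H) *: m.
Proof.
move=> m0 [_ _ mB].
have /choice[f fE] b : exists c, j b *: m = (c%:A : H) *: m.
  have [||c _ <-] := mB (j b) m; [by exists b| |by exists c].
  by exists 1 => //; rewrite !scale1r.
have [c x y|||chi chiE] := @character_ex k B f.
- apply: (kscaleI m0).
  rewrite -fE jL scalerDl kscaleAl !fE kscaleA.
  by rewrite -scalerDl -scalerDl.
- by apply: (kscaleI m0); rewrite -fE j1 !scale1r.
- move=> x y; apply: (kscaleI m0).
  by rewrite -fE jM -scalerA fE kscaleC fE kscaleA mulrC.
by exists chi => b; rewrite chiE.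
Qed.

(** [p] is the coordinate along [e] modulo [N], and [rho] is the action of [B] on the line
    [M / N]. *)
Lemma codimension_one_character (N : set M) :
  submodule_over [set j b | b in [set: B]] N -> codimension_one (k := k) N ->
  exists (p : M -> k) (rho : {lrmorphism B -> k^o}),
    [/\ klinear p, exists e, p e = 1, forall x, N x <-> p x = 0
      & forall b x, p (j b *: x) = (rho b : k) * p x].
Proof.
move=> [N0 ND NB] [e Ne /choice[p pN]].
have j0 : j 0 = 0.
  by apply: (@addrI _ (j 0)); rewrite -{1}[j 0]scale1r -jL scaler0 !addr0.
(* Scalars of [H] come from [B], so [N] is a k-subspace. *)
have jA c : j c%:A = c%:A by rewrite -[c%:A]addr0 jL j1 j0 !addr0.
have NZ c x : N x -> N ((c%:A : H) *: x).
  by rewrite -jA; apply: NB; exists c%:A.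
have NN x : N x -> N (- x).
  by move/(NZ (-1)); rewrite scaleN1r scaleN1r.
have Ninj c : N ((c%:A : H) *: e) -> c = 0.
  move=> Nc; apply/eqP/negPn/negP => c0; apply: Ne.
  by rewrite -[e]scale1r -(scale1r 1) -(mulVf c0) -kscaleA; apply: NZ.
(* Uniqueness of the coordinate; the properties of the chosen [p] below all follow from it. *)
have pU c x : N (x - (c%:A : H) *: e) -> p x = c.
  move=> Nc; apply/eqP; rewrite -subr_eq0; apply/eqP/Ninj.
  rewrite scalerBl scalerBl -[_ - _](subrKA x) addrC.
  by apply: ND => //; rewrite -opprB; apply: NN.
have pL : klinear p.
  move=> c x y; apply: pU.
  rewrite scalerDl scalerDl -kscaleA opprD addrACA -scalerBr.
  by apply: ND => //; apply: NZ.
have pe : p e = 1 by apply: pU; rewrite !scale1r subrr.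
have pNE x : N x <-> p x = 0.
  split=> [Nx|px]; first by apply: pU; rewrite !scale0r subr0.
  by have := pN x; rewrite px !scale0r subr0.
have pj b x : p (j b *: x) = p (j b *: e) * p x.
  apply: pU; rewrite mulrC -kscaleA.
  have -> : j b *: x - ((p x)%:A : H) *: (((p (j b *: e))%:A : H) *: e) =
     j b *: (x - ((p x)%:A : H) *: e) +
     ((p x)%:A : H) *: (j b *: e - ((p (j b *: e))%:A : H) *: e).
    by rewrite !scalerBr (kscaleC (j b)) addrA subrK.
  by apply: ND; [apply: NB => //; exists b|apply: NZ].
have [c x y|||rho rhoE] := @character_ex k B (fun b => p (j b *: e)).
- by rewrite jL scalerDl kscaleAl pL.
- by rewrite j1 scale1r.
- by move=> x y; rewrite jM -scalerA pj.
exists p, rho; split=> //; first by exists e.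
by move=> b x; rewrite rhoE.
Qed.

End Characters.

(** * Objects of the category as cyclic and cocyclic modules *)

Section Objects.
Variables (k : fieldType) (U A H : algType k) (t : {bilinear U -> A -> H}).
Hypothesis tP : is_tensor_product t.
Hypothesis tM : forall (u u' : U) (a a' : A), a = 1 \/ u' = 1 ->
  t u a * t u' a' = t (u * u') (a * a').

Lemma tensor11 : t 1 1 = 1.
Proof.
have tl : (fun h => t 1 1 * h) =1 id.
  apply: (@tensor_ext k U A H H t) => // [c x y|u a].
    by rewrite mulrDr -scalerAr.
  by rewrite tM; [rewrite !mul1r|left].
by rewrite -[LHS]mulr1 tl.
Qed.

Lemma tensorE u a : t u a = t u 1 * t 1 a.
Proof. by rewrite tM; [rewrite mulr1 mul1r|left]. Qed.

Lemma tensorlM u u' : t (u * u') 1 = t u 1 * t u' 1.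
Proof. by rewrite tM; [rewrite mulr1|left]. Qed.

Lemma tensorrM a a' : t 1 (a * a') = t 1 a * t 1 a'.
Proof. by rewrite tM; [rewrite mulr1|right]. Qed.

Lemma klinear_actr (M : lmodType H) (p : M -> k) h x : klinear p ->
  forall c h1 h2, p ((h * (c *: h1 + h2)) *: x) =
    c * p ((h * h1) *: x) + p ((h * h2) *: x).
Proof. by move=> pL c h1 h2; rewrite mulrDr -scalerAr scalerDl kscaleAl pL. Qed.

(** On a pure tensor, [a] acts on [m] by [chi a], leaving only [u]. Since [tensor_ext] needs a
    k-space as target, the identity is tested through the scalars [p (t 1 a *: x)], which suffice by
    separation. *)
Lemma act_eigenvector (M : lmodType H) (chi : {lrmorphism A -> k^o})
    (m : M) (p : M -> k) :
  (forall a, t 1 a *: m = ((chi a : k)%:A : H) *: m) -> klinear p ->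
  (forall x y, (forall a, p (t 1 a *: x) = p (t 1 a *: y)) -> x = y) ->
  forall h, h *: m = t (id_tensor tP chi h) 1 *: m.
Proof.
move=> chiE pL sep h; apply: sep => a; rewrite !scalerA.
pose act h := t (id_tensor tP chi h) 1.
apply: (@tensor_ext k U A H k^o t (fun h => p ((t 1 a * h) *: m))
  (fun h => p ((t 1 a * act h) *: m)) tP (klinear_actr _ m pL)).
  by move=> c h1 h2; rewrite /act linearP linearPl; apply: klinear_actr.
move=> u a'; rewrite /act id_tensorE linearZl_LR -scalerAr.
by rewrite (tensorE u a') mulrA -scalerA chiE [in RHS]kscaleAl kscaleC.
Qed.

(** Working form of an object: [m] spans the stable line, the kernel of [p] is the stable
    hyperplane, [cc_gen] is cyclicity over [U], and [cc_sep] is the dual property over [A]. *)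
Record cyclic_cocyclic (M : lmodType H) (chi : {lrmorphism A -> k^o})
    (rho : {lrmorphism U -> k^o}) (m : M) (p : M -> k) : Prop := {
  cc_chi : forall a, t 1 a *: m = ((chi a : k)%:A : H) *: m;
  cc_klinear : klinear p;
  cc_rho : forall u x, p (t u 1 *: x) = (rho u : k) * p x;
  cc_neq0 : p m != 0;
  cc_sep : forall x y,
    (forall a, p (t 1 a *: x) = p (t 1 a *: y)) -> x = y;
  cc_gen : forall x, exists u, x = t u 1 *: m }.

Lemma HM_object_cc (M : lmodType H) : HM_object t M ->
  exists chi rho (m : M) p, cyclic_cocyclic chi rho m p.
Proof.
move=> [[L [LA [m m0 Lm] Lgen]] [N [NU Ncod Nsub]]]; subst L.
have [chi chiE] := eigenvector_character (j := fun a => t 1 a)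
  (fun c => linearPr t 1 c) tensor11 tensorrM m0 LA.
have [p [rho [pL [e pe] pN pU]]] := codimension_one_character
  (j := fun u => t u 1) (fun c => linearPl t 1 c) tensor11 tensorlM NU Ncod.
have sep0 z : (forall a, p (t 1 a *: z) = 0) -> z = 0.
  move=> pz0; have pz h : p (h *: z) = 0.
    rewrite -[h]mul1r; apply: (@tensor_ext k U A H k^o t
      (fun h => p ((1 * h) *: z)) (fun=> 0) tP (klinear_actr 1 z pL)).
      by move=> c _ _; rewrite scaler0 addr0.
    by move=> u a; rewrite mul1r tensorE -scalerA pU pz0 mulr0.
  (* This is the largest H-submodule inside the kernel of [p], which is [N]. *)
  suff P0 : [set x | forall h, p (h *: x) = 0] = [set 0].
    have : [set x | forall h, p (h *: x) = 0] z by [].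
    by rewrite P0.
  apply: Nsub; last by move=> x /(_ 1); rewrite scale1r => /pN.
  split=> [h|x y xP yP h|h x _ xP h'] /=; first by rewrite scaler0 klinear0.
    by rewrite scalerDr klinearD // xP yP addr0.
  by rewrite scalerA.
have sep x y : (forall a, p (t 1 a *: x) = p (t 1 a *: y)) -> x = y.
  move=> xy; apply: subr0_eq; apply: sep0 => a.
  by rewrite scalerBr klinearB // xy subrr.
have gen x : exists u, x = t u 1 *: m.
  have actE := act_eigenvector chiE pL sep.
  suff UmT : [set x | exists u, x = t u 1 *: m] = [set: M].
    have : [set: M] x by [].
    by rewrite -UmT.
  apply: Lgen.
  - split=> [|_ _ [u ->] [u' ->]|h _ _ [u ->]].
    + by exists 0; rewrite linear0l scale0r.
    + by exists (u + u'); rewrite linearDl scalerDl.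
    (* [act_eigenvector] moves [h * t u 1] back into [U], so the [U]-orbit of [m] is H-stable. *)
    + by exists (id_tensor tP chi (h * t u 1)); rewrite scalerA actE.
  - by move=> _ [c _ <-]; exists c%:A; rewrite linearZl_LR tensor11.
exists chi, rho, m, p; split=> //.
(* If [p m = 0], then [p] vanishes on all of [U m], contradicting [p e = 1]. *)
apply/eqP => pm0; have [u eu] := gen e.
by have := oner_eq0 k; rewrite -pe eu pU pm0 mulr0 eqxx.
Qed.

(** On pure tensors both sides are [rho u * chi a * p m]. The form with [tensor_id] lets the
    hypothesis on [A'] evaluate [t 1 a * t u 1]. *)
Lemma cc_pairing (M : lmodType H) chi rho (m : M) p :
  cyclic_cocyclic chi rho m p ->
  forall h, p (h *: m) = (chi (tensor_id tP rho h) : k) * p m.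
Proof.
move=> MP h; rewrite -[h in LHS]mul1r.
apply: (@tensor_ext k U A H k^o t (fun h => p ((1 * h) *: m))
  (fun h => (chi (tensor_id tP rho h) : k) * p m)) => //.
- exact/klinear_actr/(cc_klinear MP).
- by move=> c x y /=; rewrite linearP characterP mulrDl -mulrA.
move=> u a; rewrite mul1r tensorE -scalerA (cc_rho MP).
rewrite (cc_chi MP) klinearZ; last exact: cc_klinear MP.
by rewrite -tensorE tensor_idE characterZ mulrA.
Qed.

(** Both sides give [chi a * p n] under [p (t 1 a *: _)]; applying [p] itself dictates the
    coefficient. *)
Lemma cc_eigenvector (M : lmodType H) chi rho (m : M) p (n : M)
    (chi' : {lrmorphism A -> k^o}) :
  cyclic_cocyclic chi rho m p ->
  (forall a, t 1 a *: n = ((chi' a : k)%:A : H) *: n) -> chi' =1 chi ->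
  n = ((p n / p m)%:A : H) *: m.
Proof.
move=> MP nE chiE; apply: (cc_sep MP) => a.
have pL := cc_klinear MP.
rewrite nE kscaleC (cc_chi MP) kscaleA !klinearZ // chiE mulrAC.
by rewrite divfK ?(cc_neq0 MP) // mulrC.
Qed.

Lemma cc_functional (M : lmodType H) chi rho (m : M) p (q : M -> k)
    (rho' : {lrmorphism U -> k^o}) :
  cyclic_cocyclic chi rho m p ->
  (forall u x, q (t u 1 *: x) = (rho' u : k) * q x) -> rho' =1 rho ->
  forall x, q x = q m / p m * p x.
Proof.
move=> MP qE rhoE x; have [u ->] := cc_gen MP x.
rewrite qE rhoE (cc_rho MP) mulrCA.
by rewrite divfK ?(cc_neq0 MP).
Qed.

(** * Uniqueness of characters from the subalgebras, and its consequences *)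

Variable U' : set U.
Hypothesis U'_act : forall (u : U) (a : A) (chi : {lrmorphism A -> k^o})
  (u' : U), U' u' -> act_chi tP chi u a u' = (chi a : k) *: (u * u').
Hypothesis U'_inj : restriction_one_one U'.
Variable A' : set A.
Hypothesis A'_act : forall (a' : A) (rho : {lrmorphism U -> k^o}) (u : U)
  (a : A), A' a' -> act_rho tP rho a' u a = (rho u : k) *: (a' * a).
Hypothesis A'_inj : restriction_one_one A'.

(** Write [x] as [t u 1 *: m]: by [cc_pairing] and the hypothesis on [A'], [a] passes across [u] at
    the cost of [rho u]. *)
Lemma cc_functional_A' (M : lmodType H) chi rho (m : M) p a x :
  cyclic_cocyclic chi rho m p -> A' a ->
  p (t 1 a *: x) = (chi a : k) * p x.
Proof.
move=> MP A'a; have [u ->] := cc_gen MP x.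
rewrite scalerA (cc_pairing MP).
have := A'_act rho u 1 A'a; rewrite /act_rho !mulr1 => ->.
by rewrite characterZ (cc_rho MP) mulrCA mulrA.
Qed.

(** The hypothesis on [U'] turns [a u m] into [chi a] times [u m], so both sides pair with each [a]
    to [chi a * rho u * p m]. *)
Lemma cc_eigenvector_U' (M : lmodType H) chi rho (m : M) p u :
  cyclic_cocyclic chi rho m p -> U' u ->
  t u 1 *: m = ((rho u : k)%:A : H) *: m.
Proof.
move=> MP Uu; have pL := cc_klinear MP.
have chiE := cc_chi MP.
have actE := act_eigenvector chiE pL (cc_sep MP).
apply: (cc_sep MP) => a.
have := U'_act 1 a chi Uu; rewrite /act_chi !mul1r => au.
rewrite scalerA actE au linearZl_LR kscaleAl kscaleC chiE.
by rewrite !klinearZ // (cc_rho MP) mulrCA.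
Qed.

(** For [a] in [A'], computing [p (t 1 a *: n)] in two ways gives [chi' a * p n = chi a * p n]. Here
    [p n] is nonzero, since otherwise [p] kills [A n] and separation gives [n = 0]. *)
Lemma cc_chi_unique (M : lmodType H) chi rho (m : M) p (n : M)
    (chi' : {lrmorphism A -> k^o}) :
  cyclic_cocyclic chi rho m p -> n <> 0 ->
  (forall a, t 1 a *: n = ((chi' a : k)%:A : H) *: n) -> chi' =1 chi.
Proof.
move=> MP n0 nE; have pL := cc_klinear MP.
have pn : p n != 0.
  apply/eqP => pn; apply: n0; apply: (cc_sep MP) => a.
  by rewrite nE klinearZ // pn mulr0 scaler0 klinear0.
apply: A'_inj => a A'a; apply: (mulIf pn).
by rewrite -(cc_functional_A' _ MP A'a) nE klinearZ.
Qed.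

(** Dual argument: [q m = 0] would kill [q] on [U m], which is [M]; then [q (t u 1 *: m)] is
    computed in two ways for [u] in [U']. *)
Lemma cc_rho_unique (M : lmodType H) chi rho (m : M) p (q : M -> k)
    (rho' : {lrmorphism U -> k^o}) :
  cyclic_cocyclic chi rho m p -> klinear q -> (exists x, q x <> 0) ->
  (forall u x, q (t u 1 *: x) = (rho' u : k) * q x) ->
  q m != 0 /\ rho' =1 rho.
Proof.
move=> MP qL [x qx] qE.
have qm : q m != 0.
  apply/eqP => qm; have [u xE] := cc_gen MP x.
  by apply: qx; rewrite xE qE qm mulr0.
split=> //; apply: U'_inj => u U'u; apply: (mulIf qm).
by rewrite -qE (cc_eigenvector_U' MP U'u) klinearZ.
Qed.

Lemma cc_Aline (M : lmodType H) chi rho (m : M) p (L : set M) :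
  cyclic_cocyclic chi rho m p -> Asubmodule t L -> one_dimensional L ->
  L = kline (k := k) m.
Proof.
move=> MP LA [n n0 Ln]; subst L.
have [chi' nE] := eigenvector_character (j := fun a => t 1 a)
  (fun c => linearPr t 1 c) tensor11 tensorrM n0 LA.
have nm := cc_eigenvector MP nE (cc_chi_unique MP n0 nE).
set c := p n / p m in nm.
have c0 : c != 0 by apply/eqP => c0; apply: n0; rewrite nm c0 !scale0r.
apply/seteqP; split=> _ [d _ <-]; rewrite ?nm.
  by exists (d * c); rewrite ?kscaleA.
by exists (d / c); rewrite ?kscaleA ?divfK.
Qed.

Lemma cc_Ucodim (M : lmodType H) chi rho (m : M) p (N : set M) :
  cyclic_cocyclic chi rho m p -> Usubmodule t N -> codimension_one N ->
  N = [set x | p x = 0].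
Proof.
move=> MP NU Ncod.
have [q [rho' [qL [e qe] qN qU]]] := codimension_one_character
  (j := fun u => t u 1) (fun c => linearPl t 1 c) tensor11 tensorlM NU Ncod.
have [|qm rhoE] := cc_rho_unique MP qL _ qU.
  by exists e; rewrite qe; apply/eqP/oner_neq0.
have qp := cc_functional MP qU rhoE.
apply/seteqP; split=> x /=; rewrite qN qp; last by move=> ->; rewrite mulr0.
move/eqP; rewrite !mulf_eq0 invr_eq0 (negbTE qm) (negbTE (cc_neq0 MP)).
by move/eqP.
Qed.

Lemma cc_morphism (M M' : lmodType H) (f : {linear M -> M'})
    chi rho (m : M) p chi' rho' (m' : M') p' :
  cyclic_cocyclic chi rho m p -> cyclic_cocyclic chi' rho' m' p' ->
  (forall x, f x = 0) \/ bijective f.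
Proof.
move=> MP MP'; have [fm0|fm0] := pselect (f m = 0).
  left=> x; have [u ->] := cc_gen MP x.
  by rewrite linearZ_LR fm0 scaler0.
have fmE a : t 1 a *: f m = ((chi a : k)%:A : H) *: f m.
  by rewrite -!linearZ_LR (cc_chi MP).
have fm := cc_eigenvector MP' fmE (cc_chi_unique MP' fm0 fmE).
set c := p' (f m) / p' m' in fm.
have c0 : c != 0 by apply/eqP => c0; apply: fm0; rewrite fm c0 !scale0r.
have fsurj y : exists x, f x = y.
  have [u ->] := cc_gen MP' y.
  (* As [f m] is [c] times [m'], the vector [m] divided by [c] maps to [m']. *)
  exists (t u 1 *: ((c^-1%:A : H) *: m)).
  by rewrite !linearZ_LR fm kscaleA mulVf // !scale1r.
have pL' := cc_klinear MP'.
(* The pullback of [p'] is a [rho']-functional on [M], nonzero by surjectivity, hence a nonzero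
   multiple of [p]. *)
have qL : klinear (p' \o f) by move=> d x y /=; rewrite linearP pL'.
have qU u x : (p' \o f) (t u 1 *: x) = (rho' u : k) * (p' \o f) x.
  by rewrite /= linearZ_LR (cc_rho MP').
have [|qm rhoE] := cc_rho_unique MP qL _ qU.
  have [x xm'] := fsurj m'; exists x; rewrite /= xm'.
  exact/eqP/(cc_neq0 MP').
have qp := cc_functional MP qU rhoE.
have finj : injective f.
  move=> x y fxy; apply: (cc_sep MP) => a.
  have d0 : (p' \o f) m / p m != 0.
    by rewrite mulf_neq0 ?invr_eq0 // (cc_neq0 MP).
  by apply: (mulfI d0); rewrite -!qp /= !linearZ_LR fxy.
have /choice[g fg] := fsurj.
by right; exists g => // x; apply: finj; rewrite fg.
Qed.

End Objects.

Lemma linear_inverse (H : pzRingType) (M M' : lmodType H) (f : {linear M -> M'}) :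
  bijective f -> exists g : {linear M' -> M}, cancel f g /\ cancel g f.
Proof.
move=> [g fK gK].
have gL : linear g by move=> c x y; apply: (can_inj fK); rewrite linearP !gK.
pose L := GRing.isLinear.Build H M' M *:%R g gL.
by exists (HB.pack g L : {linear M' -> M}).
Qed.

Theorem corollary3p5 (k : fieldType) (U A H : algType k)
  (t : {bilinear U -> A -> H}) (tP : is_tensor_product t)
  (tM : forall (u u' : U) (a a' : A), a = 1 \/ u' = 1 ->
     t u a * t u' a' = t (u * u') (a * a'))
  (U' : set U) (U'_subalg : GRing.subalg_closed [in U'])
  (U'_act : forall (u : U) (a : A) (chi : {lrmorphism A -> k^o}) (u' : U),
     U' u' -> act_chi tP chi u a u' = (chi a : k) *: (u * u'))
  (U'_inj : restriction_one_one U')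
  (A' : set A) (A'_subalg : GRing.subalg_closed [in A'])
  (A'_act : forall (a' : A) (rho : {lrmorphism U -> k^o}) (u : U) (a : A),
     A' a' -> act_rho tP rho a' u a = (rho u : k) *: (a' * a))
  (A'_inj : restriction_one_one A') :
  (forall M : lmodType H, HM_object t M ->
     (exists! L : set M, Asubmodule t L /\ one_dimensional L) /\
     (exists! N : set M, Usubmodule t N /\ codimension_one N)) /\
  (forall (M M' : lmodType H) (f : {linear M -> M'}),
     HM_object t M -> HM_object t M' ->
     (forall x, f x = 0) \/
     (exists g : {linear M' -> M}, cancel f g /\ cancel g f)).
Proof.
have cc M : HM_object t M ->
    exists chi rho (m : M) p, cyclic_cocyclic t chi rho m p.
  exact: HM_object_cc tP tM M.
split=> [M MO|M M' f /cc[chi [rho [m [p MP]]]] /cc[chi' [rho' [m' [p' MP']]]]].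
  have [[L [LA L1 _]] [N [NU N1 _]]] := MO.
  have {MO} [chi [rho [m [p MP]]]] := cc M MO.
  have lineE := cc_Aline tM A'_act A'_inj MP.
  have codimE := cc_Ucodim tM U'_act U'_inj MP.
  split.
    by exists L; split=> // L' [LA' L1']; rewrite (lineE L) // (lineE L').
  by exists N; split=> // N' [NU' N1']; rewrite (codimE N) // (codimE N').
have [f0|/linear_inverse] := cc_morphism tM U'_act U'_inj A'_act A'_inj
  f MP MP'; by [left|right].
Qed.
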